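(* Let $L$ be a $G$-lattice. Then: (i) if $L$ is invertible, then the map from the set of $G$-isomorphisms $\mathbb{Z}\langle G\rangle\to L$ to the set of short vectors of $L$ sending $f$ to $f(1)$ is bijective; (ii) if $e\in L$ is short and $L$ is invertible, then $\{\sigma e:\sigma\in G\}$ generates the abelian group $L$; (iii) $L$ is $G$-isomorphic to $\mathbb{Z}\langle G\rangle$ if and only if $L$ is invertible and has a short vector; (iv) if $e\in L$ is short and $L$ is invertible, then the map $G\to\{\text{short vectors of }L\}$, $\sigma\mapsto\sigma e$, is bijective.
   Context: Let $G$ be a finite abelian group with a fixed element $u$ of order $2$, $n=\#G/2$. A lattice is a finitely generated abelian group with a bilinear, symmetric, positive definite $\mathbb{Z}$-valued form $\langle\cdot,\cdot\rangle$; unimodular means Gram determinant $1$. A $G$-lattice is a lattice with a homomorphism from $G$ to its form-preserving automorphisms in which $u$ acts as $-1$; a $G$-isomorphism is a form-preserving group isomorphism commuting with the $G$-actions. A $G$-lattice $L$ is invertible if it has rank $n$, is unimodular, and for every $m\in\mathbb{Z}_{>0}$ there is $e_m\in L$ such that $\{\sigma e_m+mL:\sigma\in G\}$ generates $L/mL$ as an abelian group. A vector $e$ is short if $\langle e,e\rangle=1$. The standard $G$-lattice is $\mathbb{Z}\langle G\rangle=\mathbb{Z}[G]/(u+1)$ with $G$ acting by multiplication and $\langle x,y\rangle=t(x\bar y)$, where $t(\sum a_\sigma\sigma)=a_1-a_u$ and $\overline{\sum a_\sigma\sigma}=\sum a_\sigma\sigma^{-1}$. *)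

(* Defs.v *)
From HB Require Import structures.
From mathcomp Require Import all_boot all_order all_algebra fingroup.
From mathcomp Require Import ring_quotient generic_quotient finalg.
From mathcomp Require Import boolp classical_sets functions.
From mathcomp Require Import ring lra zify.

Set Implicit Arguments.
Unset Strict Implicit.
Unset Printing Implicit Defensive.

Import Order.TTheory GRing.Theory Num.Theory.
Local Open Scope ring_scope.
Local Open Scope quotient_scope.

(* The subgroup generated by a finite family is the set of its integral linear
   combinations. *)
Definition generates (A : zmodType) (I : finType) (v : I -> A) : Prop :=
  forall x : A, exists c : I -> int, x = \sum_i v i *~ c i.

Definition independent (A : zmodType) (I : finType) (v : I -> A) : Prop :=
  forall c : I -> int, \sum_i v i *~ c i = 0 -> forall i, c i = 0.

Definition is_Zbasis (A : zmodType) (I : finType) (v : I -> A) : Prop :=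
  generates v /\ independent v.

Record lattice := Lattice {
  lattice_sort :> zmodType;
  form : lattice_sort -> lattice_sort -> int;
  lattice_fg : exists (r : nat) (v : 'I_r -> lattice_sort), generates v;
  formDl : forall x y z, form (x + y) z = form x z + form y z;
  formDr : forall x y z, form x (y + z) = form x y + form x z;
  formC : forall x y, form x y = form y x;
  form_gt0 : forall x, x != 0 -> 0 < form x x
}.

Definition has_rank (L : lattice) (r : nat) : Prop :=
  exists b : 'I_r -> L, is_Zbasis b.

Definition gram (L : lattice) (r : nat) (b : 'I_r -> L) : 'M[int]_r :=
  \matrix_(i, j) form (b i) (b j).

(* A lattice is torsion-free, hence has a Z-basis; the Gram determinant does
   not depend on its choice. *)
Definition unimodular (L : lattice) : Prop :=
  exists (r : nat) (b : 'I_r -> L), is_Zbasis b /\ \det (gram b) = 1.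

Definition short (L : lattice) (e : L) : Prop := form e e = 1.

Definition multiples (A : zmodType) (m : nat) : {pred A} :=
  fun x => `[< exists y : A, x = y *+ m >].
Arguments multiples : clear implicits.

Lemma multiples_zmod_closed (A : zmodType) m : zmod_closed (multiples A m).
Proof.
split; first by apply/asboolP; exists 0; rewrite mul0rn.
move=> _ _ /asboolP[x ->] /asboolP[y ->]; apply/asboolP.
by exists (x - y); rewrite mulrnBl.
Qed.

HB.instance Definition _ (A : zmodType) m :=
  GRing.isZmodClosed.Build A (multiples A m) (multiples_zmod_closed A m).

Definition quot_mul (A : zmodType) (m : nat) : zmodType :=
  Quotient.quot (multiples A m).

(* A finite abelian group is a finZmodType, so the group law of G is
   written additively: 0 is the neutral element, s + t the product of s and t,
   and - s the inverse of s. *)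
Record Glattice (G : finZmodType) (u : G) := GLattice {
  Glattice_lattice :> lattice;
  act : G -> Glattice_lattice -> Glattice_lattice;
  act1 : forall x, act 0 x = x;
  actM : forall s t x, act (s + t) x = act s (act t x);
  actD : forall s x y, act s (x + y) = act s x + act s y;
  act_form : forall s x y, form (act s x) (act s y) = form x y;
  act_u : forall x, act u x = - x
}.

Definition Giso (G : finZmodType) (u : G) (L M : Glattice u) (f : L -> M) : Prop :=
  [/\ {morph f : x y / x + y},
      bijective f,
      forall x y, form (f x) (f y) = form x y
    & forall s x, f (act s x) = act s (f x)].

Definition Gisomorphic (G : finZmodType) (u : G) (L M : Glattice u) : Prop :=
  exists f : L -> M, Giso f.

Definition invertible (G : finZmodType) (u : G) (L : Glattice u) : Prop :=
  [/\ has_rank L (#|G| %/ 2),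
      unimodular L
    & forall m : nat, (0 < m)%N ->
        exists e : L, generates (fun s : G => \pi_(quot_mul L m) (act s e))].

(* Z[G]: the function a stands for the formal sum of the a s times s, and the
   product gr_mul is convolution, not the pointwise product. *)
Definition group_ring (G : finZmodType) : Type := {ffun G -> int}.

Section GroupRing.
Variable G : finZmodType.
Local Notation ZG := (group_ring G).
Implicit Types (a b c : {ffun G -> int}) (s t x y : G).

HB.instance Definition _ := GRing.Zmodule.on ZG.

Definition gr_elt (s : G) : ZG := [ffun x => (x == s)%:R].
Definition gr_mul (a b : {ffun G -> int}) : ZG :=
  [ffun x => \sum_y a y * b (x - y)].

Lemma gr_mulC : commutative gr_mul.
Proof.
move=> a b; apply/ffunP=> x; rewrite !ffunE.
rewrite (reindex_inj (inv_inj (subKr x))) /=.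
by apply: eq_bigr => y _; rewrite subKr mulrC.
Qed.

Lemma gr_mulA : associative gr_mul.
Proof.
move=> a b c; apply/ffunP=> x; rewrite !ffunE.
under eq_bigr do rewrite ffunE mulr_sumr.
under [RHS]eq_bigr do rewrite ffunE mulr_suml.
rewrite [RHS]exchange_big /=; apply: eq_bigr => y _.
rewrite [RHS](reindex_inj (addrI y)) /=.
by apply: eq_bigr => z _; rewrite mulrA [y + z]addrC addrK opprD addrA addrAC.
Qed.

Lemma gr_mulE s a x : gr_mul (gr_elt s) a x = a (x - s).
Proof.
rewrite ffunE (bigD1 s) //= ffunE eqxx mul1r big1 ?addr0 // => y ys.
by rewrite ffunE (negPf ys) mul0r.
Qed.

Lemma gr_mul1 : left_id (gr_elt 0) gr_mul.
Proof. by move=> a; apply/ffunP=> x; rewrite gr_mulE subr0. Qed.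

Lemma gr_mulDl : left_distributive gr_mul (@GRing.add ZG).
Proof.
move=> a b c; apply/ffunP=> x; rewrite !ffunE -big_split /=.
by apply: eq_bigr => y _; rewrite ffunE mulrDl.
Qed.

Lemma gr_one_neq0 : gr_elt 0 != 0 :> ZG.
Proof. by apply/eqP=> /ffunP/(_ 0); rewrite !ffunE eqxx. Qed.

HB.instance Definition _ := GRing.Zmodule_isComNzRing.Build ZG
  gr_mulA gr_mulC gr_mul1 gr_mulDl gr_one_neq0.

Definition gr_bar (a : ZG) : ZG := [ffun x => a (- x)].

End GroupRing.

Definition u1_ideal (G : finZmodType) (u : G) : {pred group_ring G} :=
  fun a => `[< exists b : group_ring G, a = b * (gr_elt u + 1) >].

Section Ideal.
Variables (G : finZmodType) (u : G).
Local Notation ZG := (group_ring G).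

Let aug (a : {ffun G -> int}) : int := \sum_x a x.

Let augM (a b : ZG) : aug (a * b) = aug a * aug b.
Proof.
rewrite /aug; under eq_bigr do rewrite ffunE.
rewrite exchange_big mulr_suml /=; apply: eq_bigr => y _.
rewrite mulr_sumr (reindex_inj (addrI y)) /=.
by apply: eq_bigr => z _; rewrite [y + z]addrC addrK.
Qed.

Let aug_elt (s : G) : aug (gr_elt s) = 1.
Proof.
rewrite /aug (bigD1 s) //= ffunE eqxx big1 ?addr0 // => y ys.
by rewrite ffunE (negPf ys).
Qed.

Let augD (a b : ZG) : aug (a + b) = aug a + aug b.
Proof. by rewrite /aug -big_split; apply: eq_bigr => x _; rewrite ffunE. Qed.

Lemma u1_ideal_closed : idealr_closed (u1_ideal u).
Proof.
split.
- by apply/asboolP; exists 0; rewrite mul0r.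
- apply/asboolP=> -[b /(congr1 aug)]; rewrite augM.
  rewrite augD !(aug_elt u, aug_elt 0); lia.
- move=> c _ _ /asboolP[a ->] /asboolP[b ->]; apply/asboolP.
  by exists (c * a + b); rewrite mulrDl mulrA.
Qed.

HB.instance Definition _ :=
  isIdealr.Build ZG (u1_ideal u) u1_ideal_closed.

End Ideal.

Definition ZuG (G : finZmodType) (u : G) : comNzRingType :=
  {ideal_quot (u1_ideal u)}.

(* t, the involution and the form are defined on the quotient through
   representatives; for u of order 2 the values do not depend on these
   (Zu_tE and Zu_barE below). *)
Definition gr_t (G : finZmodType) (u : G) (a : group_ring G) : int :=
  a 0 - a u.
Definition Zu_t (G : finZmodType) (u : G) (x : ZuG u) : int := gr_t u (repr x).
Definition Zu_bar (G : finZmodType) (u : G) (x : ZuG u) : ZuG u :=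
  \pi_(ZuG u) (gr_bar (repr x)).
Definition Zu_form (G : finZmodType) (u : G) (x y : ZuG u) : int :=
  Zu_t (x * Zu_bar y).
Definition Zu_act (G : finZmodType) (u : G) (s : G) (x : ZuG u) : ZuG u :=
  \pi_(ZuG u) (gr_elt s) * x.

Section StandardGlattice.
Variables (G : finZmodType) (u : G).
Hypothesis hu : #[u]%g = 2%N.
Local Notation ZG := (group_ring G).
Local Notation ZU := (ZuG u).
Local Notation pi := (\pi_(ZuG u)).

Let uu : u + u = 0.
Proof. by have := expg_order u; rewrite hu. Qed.

Let Nu : - u = u.
Proof. by apply/eqP; rewrite -subr_eq0 -opprD uu oppr0. Qed.

Let u_neq0 : u != 0.
Proof. by apply/eqP=> u0; move: hu; rewrite u0 order1. Qed.

Let eltM (s : G) (a : ZG) (x : G) : (gr_elt s * a) x = a (x - s).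
Proof. exact: gr_mulE. Qed.

Let grD (a b : ZG) (x : G) : (a + b) x = a x + b x.
Proof. exact: ffunE. Qed.

Let idealE (b : ZG) (x : G) : (b * (gr_elt u + 1)) x = b (x + u) + b x.
Proof. by rewrite mulrDr mulr1 mulrC ffunE eltM Nu. Qed.

Let pi_eqP (a b : ZG) : pi a = pi b -> exists c : ZG, a = b + c * (gr_elt u + 1).
Proof.
move=> /eqP; rewrite -Quotient.idealrBE => /asboolP[c E].
by exists c; rewrite -E addrC subrK.
Qed.

Let pi_ideal (c : ZG) : pi (c * (gr_elt u + 1)) = 0.
Proof.
rewrite -[0]/(0 : ZU) -(rmorph0 pi); apply/eqP; rewrite -Quotient.idealrBE subr0.
by apply/asboolP; exists c.
Qed.

Lemma Zu_tE (a : ZG) : Zu_t (pi a) = gr_t u a.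
Proof.
rewrite /Zu_t; have [c ->] := pi_eqP (reprK (pi a)).
by rewrite /gr_t !grD !idealE add0r uu; ring.
Qed.

Let barM (a b : ZG) : gr_bar (a * b) = gr_bar a * gr_bar b.
Proof.
apply/ffunP=> x; rewrite !ffunE (reindex_inj oppr_inj) /=.
by apply: eq_bigr => y _; rewrite !ffunE opprB opprK addrC.
Qed.

Let barD (a b : ZG) : gr_bar (a + b) = gr_bar a + gr_bar b.
Proof. by apply/ffunP=> x; rewrite !ffunE. Qed.

Let bar_elt (s : G) : gr_bar (gr_elt s) = gr_elt (- s).
Proof. by apply/ffunP=> x; rewrite !ffunE eqr_oppLR. Qed.

Lemma Zu_barE (a : ZG) : Zu_bar (pi a) = pi (gr_bar a).
Proof.
rewrite /Zu_bar; have [c ->] := pi_eqP (reprK (pi a)).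
have bar_u1 : gr_bar (gr_elt u + 1) = gr_elt u + 1 :> ZG.
  by rewrite barD !bar_elt Nu oppr0.
by rewrite barD barM bar_u1 rmorphD /= pi_ideal addr0.
Qed.

Lemma Zu_formE (a b : ZG) : Zu_form (pi a) (pi b) = gr_t u (a * gr_bar b).
Proof. by rewrite /Zu_form Zu_barE -rmorphM Zu_tE. Qed.

Lemma Zu_actE (s : G) (a : ZG) : Zu_act s (pi a) = pi (gr_elt s * a).
Proof. by rewrite /Zu_act -rmorphM. Qed.

Let gr_tD (a b : ZG) : gr_t u (a + b) = gr_t u a + gr_t u b.
Proof. by rewrite /gr_t !ffunE; ring. Qed.

Lemma Zu_fg : exists (r : nat) (v : 'I_r -> ZU), generates v.
Proof.
exists #|G|, (fun i => pi (gr_elt (enum_val i))) => x.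
rewrite -[x]reprK; set a : ZG := repr x.
exists (fun i => a (enum_val i)).
have {1}-> : a = \sum_s gr_elt s *~ a s.
  apply/ffunP=> s; rewrite sum_ffunE (bigD1 s) //= big1 => [|t ts].
    by rewrite ffunMzE ffunE eqxx addr0 intz.
  by rewrite ffunMzE ffunE eq_sym (negPf ts) mul0rz.
rewrite rmorph_sum /= (reindex (@enum_val _ G)) /=; last first.
  by apply: onW_bij; exact: enum_val_bij.
by apply: eq_bigr => i _; rewrite rmorphMz.
Qed.

Lemma Zu_formDl (x y z : ZU) : Zu_form (x + y) z = Zu_form x z + Zu_form y z.
Proof.
rewrite -[x]reprK -[y]reprK -[z]reprK -rmorphD !Zu_formE.
by rewrite mulrDl gr_tD.
Qed.

Lemma Zu_formC (x y : ZU) : Zu_form x y = Zu_form y x.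
Proof.
rewrite -[x]reprK -[y]reprK !Zu_formE.
have bar_t a : gr_t u (gr_bar a) = gr_t u a by rewrite /gr_t !ffunE oppr0 Nu.
have barK : involutive (@gr_bar G) by move=> a; apply/ffunP=> s; rewrite !ffunE opprK.
by rewrite -bar_t barM barK mulrC.
Qed.

Lemma Zu_formDr (x y z : ZU) : Zu_form x (y + z) = Zu_form x y + Zu_form x z.
Proof. by rewrite Zu_formC Zu_formDl ![Zu_form _ x]Zu_formC. Qed.

Lemma Zu_form_gt0 (x : ZU) : x != 0 -> 0 < Zu_form x x.
Proof.
rewrite -[x]reprK; move: (repr x) => a; rewrite Zu_formE.
have form2 : gr_t u (a * gr_bar a) *+ 2 = \sum_s (a s - a (s + u)) ^+ 2.
  have E t : (a * gr_bar a) t = \sum_s a s * a (s - t).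
    by rewrite ffunE; apply: eq_bigr => s _; rewrite ffunE opprB.
  rewrite /gr_t !E.
  under eq_bigr do rewrite subr0 -expr2.
  under [X in _ - X]eq_bigr do rewrite Nu.
  under [RHS]eq_bigr do rewrite sqrrB.
  rewrite big_split sumrB /= [X in _ = _ + X](_ : _ = \sum_s a s ^+ 2).
    by rewrite sumrMnl; ring.
  rewrite (reindex_inj (addIr u)) /=.
  by apply: eq_bigr => s _; rewrite -addrA uu addr0.
have sq_ge0 s : true -> 0 <= (a s - a (s + u)) ^+ 2 by rewrite sqr_ge0.
move=> a_neq0; rewrite -(pmulrn_lgt0 _ (isT : (0 < 2)%N)) form2.
rewrite lt_neqAle sumr_ge0 // andbT eq_sym.
apply: contraNneq a_neq0 => /psumr_eq0P/(_ _ isT) sum0.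
have inv s : a (s + u) = a s.
  by have /eqP := sum0 sq_ge0 s; rewrite sqrf_eq0 subr_eq0 => /eqP.
pose b : ZG := [ffun s => if (enum_rank s < enum_rank (s + u)%R)%N then a s else 0].
suff -> : a = b * (gr_elt u + 1) by rewrite pi_ideal.
apply/ffunP=> s; rewrite idealE !ffunE -addrA uu addr0 inv.
case: ltngtP => [||/ord_inj/enum_rank_inj/eqP]; rewrite ?add0r ?addr0 //.
by rewrite -subr_eq0 addrC addKr (negPf u_neq0).
Qed.

Definition Zu_lattice : lattice :=
  @Lattice ZU (@Zu_form G u) Zu_fg Zu_formDl Zu_formDr Zu_formC Zu_form_gt0.

Lemma Zu_act1 (x : ZU) : Zu_act 0 x = x.
Proof. by rewrite /Zu_act rmorph1 mul1r. Qed.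

Let eltD (s t : G) : gr_elt (s + t) = gr_elt s * gr_elt t :> ZG.
Proof. by apply/ffunP=> x; rewrite eltM !ffunE subr_eq addrC. Qed.

Lemma Zu_actM (s t : G) (x : ZU) : Zu_act (s + t) x = Zu_act s (Zu_act t x).
Proof. by rewrite /Zu_act eltD rmorphM mulrA. Qed.

Lemma Zu_actD (s : G) (x y : ZU) : Zu_act s (x + y) = Zu_act s x + Zu_act s y.
Proof. exact: mulrDr. Qed.

Lemma Zu_act_form (s : G) (x y : ZU) :
  Zu_form (Zu_act s x) (Zu_act s y) = Zu_form x y.
Proof.
rewrite -[x]reprK -[y]reprK !Zu_actE !Zu_formE barM bar_elt.
by rewrite mulrACA -eltD subrr mul1r.
Qed.

Lemma Zu_act_u (x : ZU) : Zu_act u x = - x.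
Proof.
have u1 : pi (gr_elt u) + 1 = 0 by rewrite -(pi_ideal 1) mul1r rmorphD rmorph1.
by apply/eqP; rewrite -addr_eq0 -[X in _ + X]mul1r -mulrDl u1 mul0r.
Qed.

Definition standard_Glattice : Glattice u :=
  @GLattice G u Zu_lattice (@Zu_act G u)
    Zu_act1 Zu_actM Zu_actD Zu_act_form Zu_act_u.

End StandardGlattice.

(* Main.v *)
(* Let e be short.  By Cauchy-Schwarz <s e, e> = 0 unless s e = e or s e = - e,
   so the orbit of e is, up to sign, orthonormal.  Invertibility forces the
   stabilizer H of e to be trivial: modulo m = #|H| the lattice is free of rank
   one over Z<G>, so e, being H-invariant, is congruent to a sum over H of
   translates of some x, whence #|H| divides <e, e> = 1.  The orbit therefore
   contains n = #|G| / 2 orthonormal vectors in a lattice of rank n, and these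
   form a basis.  Such an e has the same Gram function s |-> <s e, e> as the
   element 1 of Z<G>, and everything else follows from that. *)

Require Import Defs.
From mathcomp Require Import all_boot all_order all_algebra fingroup.
From mathcomp Require Import ring_quotient generic_quotient.
From mathcomp Require Import boolp classical_sets functions.
From mathcomp Require Import ring zify.
Import Defs.

Set Implicit Arguments.
Unset Strict Implicit.
Unset Printing Implicit Defensive.
Import Order.TTheory GRing.Theory Num.Theory.

Local Open Scope ring_scope.
Local Open Scope quotient_scope.

(** * Additive maps and integral linear combinations *)

Lemma morphD0 (A B : zmodType) (f : A -> B) : {morph f : x y / x + y} -> f 0 = 0.
Proof. by move=> fD; apply: (addrI (f 0)); rewrite -fD !addr0. Qed.

Lemma morphDN (A B : zmodType) (f : A -> B) :
  {morph f : x y / x + y} -> {morph f : x / - x}.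
Proof.
by move=> fD x; apply: (addrI (f x)); rewrite -fD !subrr (morphD0 fD).
Qed.

Lemma morphDMz (A B : zmodType) (f : A -> B) (k : int) :
  {morph f : x y / x + y} -> {morph f : x / x *~ k}.
Proof.
move=> fD x; have fMn (i : nat) : f (x *+ i) = f x *+ i.
  by elim: i => [|i IH]; rewrite ?mulr0n ?(morphD0 fD) // !mulrS fD IH.
by case: k => i; rewrite /intmul ?(morphDN fD) fMn.
Qed.

Lemma morphD_lincomb (A B : zmodType) (f : A -> B) (I : finType) (P : pred I)
    (v : I -> A) (c : I -> int) :
  {morph f : x y / x + y} ->
  f (\sum_(i | P i) v i *~ c i) = \sum_(i | P i) f (v i) *~ c i.
Proof.
move=> fD; rewrite (big_morph f fD (morphD0 fD)).
by apply: eq_bigr => i _; rewrite morphDMz.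
Qed.

Lemma lincomb_lincomb (A : zmodType) (I J : finType) (w : J -> A) (M : I -> J -> int)
    (c : I -> int) :
  \sum_i (\sum_j w j *~ M i j) *~ c i = \sum_j w j *~ (\sum_i c i * M i j).
Proof.
under eq_bigr do rewrite mulrz_suml.
rewrite exchange_big; apply: eq_bigr => j _ /=.
by rewrite mulrz_sumr; apply: eq_bigr => i _; rewrite -mulrzA mulrC.
Qed.

Lemma generates_comp (A : zmodType) (I J : finType) (h : I -> J) (v : J -> A) :
  generates (fun i => v (h i)) -> generates v.
Proof.
move=> gen x; have [c ->] := gen x.
exists (fun j => \sum_(i | h i == j) c i).
rewrite (partition_big h xpredT) //=; apply: eq_bigr => j _.
by rewrite mulrz_sumr; apply: eq_bigr => i /eqP ->.
Qed.

(** * Coordinates in a Z-basis and reduction modulo [m] *)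

Section ZBases.
Variables (A : zmodType) (n : nat) (b : 'I_n -> A).
Hypothesis b_basis : is_Zbasis b.

Lemma Zbasis_coord_inj (c d : 'I_n -> int) :
  \sum_i b i *~ c i = \sum_i b i *~ d i -> c =1 d.
Proof.
move=> E i; apply/eqP; rewrite -subr_eq0; apply/eqP.
apply: (b_basis.2 (fun i => c i - d i)).
by under eq_bigr do rewrite mulrzBr; rewrite sumrB E subrr.
Qed.

Lemma Zbasis_matrix (k : nat) (v : 'I_k -> A) :
  exists M : 'M[int]_(k, n), forall i, v i = \sum_j b j *~ M i j.
Proof.
have [M vM] := choice (fun i => b_basis.1 (v i)).
exists (\matrix_(i, j) M i j) => i; rewrite {1}vM.
by apply: eq_bigr => j _; rewrite mxE.
Qed.

(* The square matrix expressing v in the basis is left invertible modulo m,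
   hence also right invertible. *)
Lemma generators_mod_independent (m : nat) (v : 'I_n -> A) (y : A)
    (c : 'I_n -> int) :
  (1 < m)%N ->
  (forall x, exists (d : 'I_n -> int) z, x = \sum_i v i *~ d i + z *+ m) ->
  \sum_i v i *~ c i = y *+ m -> forall i, (c i)%:~R = 0 :> 'Z_m.
Proof.
move=> m_gt1 v_gen cE.
have [M vM] := Zbasis_matrix v.
have [N /choice[Y bN]] := choice (fun i => v_gen (b i)).
have [Z YZ] := Zbasis_matrix Y.
pose W := \matrix_(i, j) N i j.
(* The type ['Z_m] is the ring of integers modulo [m] only for [m] above 1, hence [m_gt1]. *)
have m0 : m%:Z%:~R = 0 :> 'Z_m by rewrite -pmulrn pchar_Zp.
have WM1 : map_mx intr W *m map_mx intr M = 1%:M :> 'M['Z_m]_n.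
  rewrite -map_mxM; apply/matrixP=> i j; rewrite !mxE.
  have := bN i; under eq_bigr do rewrite vM.
  rewrite lincomb_lincomb YZ pmulrn mulrz_suml -big_split /=.
  under eq_bigr do rewrite -mulrzA -mulrzDr_tmp.
  have -> : b i = \sum_k b k *~ (i == k)%:R.
    rewrite (bigD1 i) //= eqxx mulr1z big1 ?addr0 // => k ki.
    by rewrite eq_sym (negPf ki) mulr0z.
  move/Zbasis_coord_inj/(_ j)/(congr1 (intr : int -> 'Z_m)).
  rewrite intrD intrM m0 mulr0 addr0 => E.
  under eq_bigr do rewrite mxE.
  by rewrite -E; case: (i == j).
have MW1 := mulmx1C WM1.
pose C := \row_i c i.
suff : map_mx intr C = 0 :> 'rV['Z_m]_n.
  by move=> C0 i; move/matrixP/(_ 0 i): C0; rewrite !mxE.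
(* Modulo [m] the row [C] equals [C M W], and [C M] is the coordinate row of [y *+ m], which
   vanishes. *)
rewrite -[map_mx _ _]mulmx1 -MW1 mulmxA -map_mxM.
suff -> : map_mx intr (C *m M) = 0 :> 'rV['Z_m]_n by rewrite mul0mx.
apply/matrixP=> i j; rewrite !mxE.
have [d yd] := b_basis.1 y.
move: cE; under eq_bigr do rewrite vM.
rewrite lincomb_lincomb yd pmulrn mulrz_suml.
under [X in _ = X -> _]eq_bigr do rewrite -mulrzA.
move/Zbasis_coord_inj/(_ j)/(congr1 (intr : int -> 'Z_m)).
rewrite intrM m0 mulr0 => E.
by under eq_bigr do rewrite mxE.
Qed.

End ZBases.

(** * Short vectors and orthonormal families in a lattice *)

Section Forms.
Variable L : lattice.
Implicit Types x y z : L.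

Lemma form_morphl y : {morph (@form L)^~ y : x z / x + z}.
Proof. by move=> x z; exact: formDl. Qed.

Lemma formNl x y : form (- x) y = - form x y.
Proof. exact: (morphDN (form_morphl y)). Qed.

Lemma form_lincombl (I : finType) (P : pred I) (v : I -> L) (c : I -> int) y :
  form (\sum_(i | P i) v i *~ c i) y = \sum_(i | P i) c i * form (v i) y.
Proof.
rewrite (morphD_lincomb P v c (form_morphl y)).
by apply: eq_bigr => i _; rewrite mulrzz mulrC.
Qed.

Lemma form_eq0 x : form x x = 0 -> x = 0.
Proof. by move=> x0; apply/eqP/negPn/negP=> /form_gt0; rewrite x0. Qed.

Lemma short_neqN x : short x -> x != - x.
Proof.
move=> sx; apply/eqP=> xN; have : form (- x) x = 1 by rewrite -xN.
by rewrite formNl sx.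
Qed.

(** With [a] the value of the form at [x] and [y], the vector [x - a y] has norm [1 - a^2], which is
    nonnegative. As [a] is a nonzero integer, it is 1 or -1, and [x - a y] has norm zero. *)
Lemma short_orthogonal x y :
  short x -> short y -> form x y != 0 -> x = y \/ x = - y.
Proof.
move=> sx sy; set a := form x y => a0.
pose z := x - y *~ a.
have zz : form z z = 1 - a * a.
  have yMz w : form (y *~ a) w = form y w * a.
    by rewrite (morphDMz a (form_morphl w)) mulrzz.
  rewrite /z formDl formNl yMz [form x _]formC [form y _]formC !formDl !formNl.
  by rewrite !yMz [form y x]formC sx sy -/a; ring.
have zz_ge0 : 0 <= form z z.
  have [->|/form_gt0/ltW //] := eqVneq z 0.
  by rewrite (morphD0 (form_morphl 0)).
have aa : a = 1 \/ a = -1 by move: zz_ge0 a0; rewrite zz; nia.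
have /eqP : z = 0 by apply: form_eq0; rewrite zz; case: aa => ->.
by rewrite subr_eq0 => /eqP ->; case: aa => ->; [left|right]; rewrite ?mulr1z ?mulrN1z.
Qed.

(* Writing A for the coordinate matrix of v, orthonormality says that A times
   the matrix of the <b j, v k> is the identity; the product in the other order
   then expresses every b j through v. *)
Lemma orthonormal_generates (n : nat) (b v : 'I_n -> L) :
  is_Zbasis b -> (forall i j, form (v i) (v j) = (i == j)%:R) -> generates v.
Proof.
move=> b_basis von.
have [A vA] := Zbasis_matrix b_basis v.
pose X : 'M[int]_n := \matrix_(j, k) form (b j) (v k).
have AX : A *m X = 1%:M.
  apply/matrixP=> i k; rewrite !mxE -von {1}vA form_lincombl.
  by apply: eq_bigr => j _; rewrite mxE.
have bE j : b j = \sum_k v k *~ X j k.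
  under eq_bigr do rewrite vA.
  rewrite lincomb_lincomb (bigD1 j) //= [X in _ + X]big1 => [|i ij].
    rewrite addr0 -[LHS]mulr1z; congr (_ *~ _).
    by have /matrixP/(_ j j) := mulmx1C AX; rewrite !mxE eqxx.
  rewrite -[RHS](mulr0z (b i)); congr (_ *~ _).
  by have /matrixP/(_ j i) := mulmx1C AX; rewrite !mxE eq_sym (negPf ij).
move=> x; have [c ->] := b_basis.1 x.
under eq_bigr do rewrite bE.
by rewrite lincomb_lincomb; eexists.
Qed.

Lemma orthonormal_independent (I : finType) (v : I -> L) :
  (forall i j, form (v i) (v j) = (i == j)%:R) -> independent v.
Proof.
move=> von c c0 i; have := form_lincombl xpredT v c (v i).
rewrite c0 (morphD0 (form_morphl _)) (bigD1 i) //= von eqxx mulr1 big1 ?addr0 //.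
by move=> j ji; rewrite von (negPf ji) mulr0.
Qed.

End Forms.

(** * Additive isometries *)

Lemma isometry_on_generators (L M : lattice) (f : L -> M) (I : finType)
    (v : I -> L) :
  {morph f : x y / x + y} -> generates v ->
  (forall i j, form (f (v i)) (f (v j)) = form (v i) (v j)) ->
  forall x y, form (f x) (f y) = form x y.
Proof.
move=> fD gen fv x y; have [c ->] := gen x; have [d ->] := gen y.
rewrite !(morphD_lincomb _ _ _ fD) !form_lincombl; apply: eq_bigr => i _.
congr (_ * _); rewrite formC [RHS]formC !form_lincombl.
by apply: eq_bigr => j _; rewrite formC fv formC.
Qed.

Lemma isometry_inj (L M : lattice) (f : L -> M) :
  {morph f : x y / x + y} -> (forall x y, form (f x) (f y) = form x y) ->
  injective f.
Proof.
move=> fD fI x y xy; apply/eqP; rewrite -subr_eq0; apply/eqP/form_eq0.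
by rewrite -fI fD (morphDN fD) xy subrr (morphD0 (form_morphl _)).
Qed.

(** * Transversals of the subgroup generated by [u] *)

Section HalfSystems.
Variables (G : finZmodType) (u : G).
Hypothesis hu : #[u]%g = 2%N.

Lemma order2_addr : u + u = 0.
Proof. by have := expg_order u; rewrite hu. Qed.

Lemma order2_addrK (s : G) : s + u + u = s.
Proof. by rewrite -addrA order2_addr addr0. Qed.

Lemma order2_opp : - u = u.
Proof. by apply/eqP; rewrite -subr_eq0 -opprD order2_addr oppr0. Qed.

Lemma order2_neq0 : u != 0.
Proof. by apply/eqP=> u0; move: hu; rewrite u0 order1. Qed.

Lemma order2_addr_neq (s : G) : s + u != s.
Proof. by rewrite -subr_eq0 addrAC subrr add0r order2_neq0. Qed.

(** Exactly one of [s] and [s + u] lies in [S]. Since [u] acts as -1, translates by [S] make up a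
    whole orbit up to sign. *)
Definition half_system (S : {set G}) := forall s, (s + u \in S) = (s \notin S).

(** From each pair [s], [s + u] the element with the smaller key is kept. The key is left free so
    that it can later be taken constant on the cosets of a stabilizer. *)
Lemma half_systemI (k : G -> nat) :
  (forall s, k (s + u) != k s) -> half_system [set s | (k s < k (s + u)%R)%N].
Proof.
by move=> ku s; rewrite !inE order2_addrK -leqNgt ltn_neqAle ku.
Qed.

Lemma half_system_exists : exists S, half_system S.
Proof.
eexists; apply: (@half_systemI (fun s => enum_rank s)) => s.
by apply: contraNneq (order2_addr_neq s) => /ord_inj/enum_rank_inj ->.
Qed.

Variable S : {set G}.
Hypothesis hS : half_system S.

Lemma half_system_sum (A : zmodType) (F : G -> A) :
  \sum_s F s = \sum_(s in S) (F s + F (s + u)).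
Proof.
rewrite (bigID (mem S)) big_split /=; congr (_ + _).
rewrite (reindex_inj (addIr u)) /=.
by apply: eq_bigl => s; rewrite hS negbK.
Qed.

Lemma half_system_card : #|S| = (#|G| %/ 2)%N.
Proof.
have := half_system_sum (fun=> 1 : int); rewrite !sumr_const => /eqP.
by rewrite -mulr2n -mulrnA eqr_nat => /eqP ->; rewrite mulKn.
Qed.

End HalfSystems.

(** Trades the quotient for congruences in [A] with an explicit witness [y]. *)
Lemma generates_quot_mulP (A : zmodType) (m : nat) (I : finType) (v : I -> A) :
  generates (fun i => \pi_(quot_mul A m) (v i)) <->
  forall x, exists (c : I -> int) y, x = \sum_i v i *~ c i + y *+ m.
Proof.
have piE (c : I -> int) : \sum_i \pi_(quot_mul A m) (v i) *~ c i =
    \pi_(quot_mul A m) (\sum_i v i *~ c i).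
  by rewrite raddf_sum; apply: eq_bigr => i _; rewrite raddfMz.
split=> [gen x|gen x].
  have [c] := gen (\pi_(quot_mul A m) x); rewrite piE => /eqP.
  rewrite -Quotient.idealrBE => /asboolP[y E].
  by exists c, y; rewrite -E addrC subrK.
have [c [y E]] := gen (repr x); exists c.
rewrite piE -[x]reprK; apply/eqP; rewrite -Quotient.idealrBE.
by apply/asboolP; exists y; rewrite E addrAC subrr add0r.
Qed.

(** * The [G]-action and stabilizers of short vectors *)

Section GLattices.
Variables (G : finZmodType) (u : G).
Hypothesis hu : #[u]%g = 2%N.
Variable L : Glattice u.
Implicit Types (s t : G) (x y e : L).

Lemma actN s x : act s (- x) = - act s x.
Proof. exact: (morphDN (actD s)). Qed.

Lemma act_addu s x : act (s + u) x = - act s x.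
Proof. by rewrite actM act_u actN. Qed.

Lemma act_short s e : short e -> short (act s e).
Proof. by rewrite /short act_form. Qed.

Lemma form_act s t x y : form (act s x) (act t y) = form (act (s - t) x) y.
Proof. by rewrite -[RHS](act_form t) -actM addrC subrK. Qed.

Lemma act_eqP s t x : act s x = act t x <-> act (s - t) x = x.
Proof.
split=> [st|st]; last by rewrite -[in RHS]st -actM addrC subrK.
by rewrite addrC actM st -actM addNr act1.
Qed.

Lemma half_system_act (S : {set G}) (c : G -> int) x : half_system u S ->
  \sum_s act s x *~ c s = \sum_(s in S) act s x *~ (c s - c (s + u)).
Proof.
move=> hS; rewrite (half_system_sum hS); apply: eq_bigr => s _.
by rewrite act_addu mulNrz mulrzBr.
Qed.

(** The translates of [e] by [S] already generate modulo [m], and their number is the rank, so they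
    are independent modulo [m]. Here [e] plays the role of the vector [e_m] of invertibility. *)
Lemma half_system_mod_independent (S : {set G}) (m : nat) e (c : G -> int) y :
  half_system u S -> has_rank L (#|G| %/ 2) -> (1 < m)%N ->
  generates (fun s => \pi_(quot_mul L m) (act s e)) ->
  \sum_(s in S) act s e *~ c s = y *+ m ->
  forall s, s \in S -> (c s)%:~R = 0 :> 'Z_m.
Proof.
move=> hS + m_gt1 /generates_quot_mulP gen cE s sS.
rewrite -(half_system_card hS) => -[b b_basis].
rewrite big_enum_val in cE; rewrite -(enum_rankK_in sS sS).
apply: (generators_mod_independent (v := fun i => act (enum_val i) e)
  (c := fun i => c (enum_val i)) b_basis m_gt1 _ cE) => x.
have [d [z ->]] := gen x; rewrite (half_system_act _ _ hS) big_enum_val.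
by exists (fun i => d (enum_val i) - d (enum_val i + u)), z.
Qed.

(* For the stabilizer H of e and m = #|H|, write e as a combination of the
   sigma e_m modulo m.  Its coefficients are unique, hence constant on H-cosets,
   so that <e, e> is a sum of #|H|-fold multiples modulo m. *)
Lemma short_stabilizer_trivial e t :
  short e -> invertible L -> act t e = e -> t = 0.
Proof.
move=> se [rkL _ gen] te; apply/eqP/negPn/negP=> t0.
(* The coset of [s] modulo the stabilizer of [e], written as a fibre of the orbit map. *)
pose cls s := [set r | act r e == act s e].
have cls_act s r : act s e = act r e -> cls s = cls r.
  by move=> E; apply/finset.setP=> q; rewrite !inE E.
have act_cls s r : cls s = cls r -> act s e = act r e.
  by move/finset.setP/(_ s); rewrite !inE eqxx => /esym/eqP.
pose m := #|cls 0|.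
have card_cls s : #|cls s| = m.
  rewrite -[RHS](card_imset _ (addIr s)); apply: eq_card => r.
  apply/idP/imsetP=> [|[q + ->]]; rewrite !inE ?act1 => /eqP E.
    by exists (r - s); rewrite ?subrK // !inE act1; apply/eqP/act_eqP.
  by rewrite addrC actM E.
have m_gt1 : (1 < m)%N.
  by rewrite /m (cardD1 0) (cardD1 t) !inE !act1 te !eqxx t0.
(* A key constant on these cosets makes [S] a union of them. It separates [s] from [s + u] because
   [s e] differs from [- s e]. *)
pose k s : nat := enum_rank (cls s).
pose S := [set s | (k s < k (s + u)%R)%N].
have hS : half_system u S.
  apply: half_systemI => // s; apply/eqP => /ord_inj/enum_rank_inj/act_cls.
  by rewrite act_addu => /esym/eqP; rewrite (negPf (short_neqN (act_short s se))).
have S_act s r : act s e = act r e -> (s \in S) = (r \in S).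
  move=> E; rewrite !inE /k (cls_act _ _ E) (cls_act (s + u) (r + u)) //.
  by rewrite !act_addu E.
have [em em_gen] := gen m (ltnW m_gt1).
have /generates_quot_mulP/(_ e)[c0 [y eE]] := em_gen.
pose c s := c0 s - c0 (s + u).
(* Applying [h] to the expansion of [e] shifts its coefficients by [h]. *)
have eS h : act h e = \sum_(s in S) act s em *~ c (s - h) + act h y *+ m.
  rewrite {1}eE actD pmulrn (morphDMz _ (actD h)) -pmulrn; congr (_ + _).
  rewrite (morphD_lincomb _ _ _ (actD h)) (reindex_inj (addIr (- h))) /=.
  under eq_bigr do rewrite -actM addrC subrK.
  rewrite (half_system_act (fun s => c0 (s - h)) _ hS).
  by apply: eq_bigr => s _; rewrite /c [s - h + u]addrAC.
pose phi (a : int) : 'Z_m := a%:~R.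
have phiD : {morph phi : a b / a + b} by move=> a b; exact: intrD.
have phiM : {morph phi : a b / a * b} by move=> a b; exact: intrM.
have m0 : m%:R = 0 :> 'Z_m by rewrite pchar_Zp.
(* With [h = s - r] fixing [e], the expansions [eS 0] and [eS h] both represent [e]. Their
   difference is a relation modulo [m], so its coefficients vanish there. *)
have c_inv s r : s \in S -> act s e = act r e -> phi (c s) = phi (c r).
  move=> sS /act_eqP; set h := s - r => hE.
  have rE : r = s - h by rewrite opprB addrC subrK.
  apply/eqP; rewrite -subr_eq0 -intrB rE; apply/eqP.
  apply: (half_system_mod_independent (c := fun s => c s - c (s - h))
    (y := act h y - y) hS rkL m_gt1 em_gen) => //.
  under eq_bigr do rewrite mulrzBr.
  have /eqP := eS 0; rewrite sumrB !act1; under eq_bigr do rewrite subr0.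
  rewrite -subr_eq => /eqP <-; have /eqP := eS h.
  rewrite hE -subr_eq => /eqP <-.
  by rewrite mulrnBl opprB addrCA [e - _ - e]addrAC subrr add0r.
pose g s := phi (c s) * phi (form (act s em) e).
have g_inv s r : s \in S -> act s e = act r e -> g s = g r.
  move=> sS E; rewrite /g (c_inv s r) //; congr (_ * phi _).
  (* Moving [q] to the other argument shows that the pairing depends only on the coset of [q]. *)
  have actVE q : form (act q em) e = form em (act (- q) e).
    by rewrite -[in RHS](act1 em) form_act add0r opprK.
  rewrite !actVE; congr (form _ _); apply/act_eqP.
  by rewrite opprK addrC; apply/act_eqP.
have sum_g : phi (form e e) = \sum_(s in S) g s.
  have := eS 0; rewrite !act1; under eq_bigr do rewrite subr0.
  move=> e0; rewrite {1}e0 formDl form_lincombl pmulrn.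
  rewrite (morphDMz _ (form_morphl e)) mulrzz phiD phiM.
  rewrite [phi m](_ : _ = 0) ?mulr0 ?addr0; last by rewrite /phi -pmulrn.
  rewrite (big_morph phi phiD (morphD0 phiD)).
  by apply: eq_bigr => s _; rewrite phiM.
suff g0 : \sum_(s in S) g s = 0.
  by move/eqP: sum_g; rewrite se g0 /phi oner_eq0.
(* A coset either misses [S] or lies inside it, and then contributes [m] equal terms, which is zero
   in ['Z_m]. *)
rewrite (partition_big cls xpredT) //= big1 // => C _.
case: (pickP [pred s | (s \in S) && (cls s == C)]) => [s0 /= /andP[s0S /eqP s0C]|none].
  rewrite (eq_bigr (fun=> g s0)) => [|s /andP[sS /eqP sC]]; last first.
    by apply: g_inv => //; apply: act_cls; rewrite sC.
  rewrite sumr_const -[X in X *+ _]mulr1 -mulrnAr.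
  suff -> : #|[pred s | (s \in S) && (cls s == C)]| = m by rewrite m0 mulr0.
  rewrite -(card_cls s0); apply: eq_card => s; rewrite !inE -s0C.
  apply/andP/eqP => [[_ /eqP/act_cls]//|E].
  by have := S_act _ _ E; rewrite s0S inE => ->; rewrite (cls_act _ _ E).
by rewrite big_pred0.
Qed.

End GLattices.

(** * Vectors whose orbit has the Gram function of 1 in Z<G> *)

Section Frames.
Variables (G : finZmodType) (u : G).
Hypothesis hu : #[u]%g = 2%N.

(* The prescribed values of <s e, e> are those for e = 1 in Z<G>. *)
Definition Gframe (L : Glattice u) (e : L) : Prop :=
  generates (fun s : G => act s e) /\
  forall s : G, form (act s e) e = (s == 0)%:R - (s == u)%:R.

Lemma Gframe_short (L : Glattice u) (e : L) : Gframe e -> short e.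
Proof.
by case=> _ /(_ 0); rewrite act1 eqxx eq_sym (negPf (order2_neq0 hu)) subr0.
Qed.

(** Two elements of [S] never differ by [u], so only the term at 0 of the Gram function survives. *)
Lemma half_system_orthonormal (L : Glattice u) (e : L) (S : {set G}) :
  half_system u S ->
  (forall s : G, form (act s e) e = (s == 0)%:R - (s == u)%:R) ->
  forall i j : 'I_#|S|,
    form (act (enum_val i) e) (act (enum_val j) e) = (i == j)%:R.
Proof.
move=> hS eE i j; rewrite form_act eE subr_eq0 (inj_eq enum_val_inj).
suff /negPf -> : enum_val i - enum_val j != u by rewrite subr0.
apply/negP=> /eqP/(canRL (subrK _)); rewrite addrC => ij.
by have := hS (enum_val j); rewrite -ij !enum_valP.
Qed.

(** If [s e] is not orthogonal to [e], it is [e] or [- e], so [s] or [s + u] fixes [e] and hence is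
    0. The half orbit is then an orthonormal family of size the rank, which generates. *)
Lemma invertible_short_Gframe (L : Glattice u) (e : L) :
  invertible L -> short e -> Gframe e.
Proof.
move=> invL se.
have eE s : form (act s e) e = (s == 0)%:R - (s == u)%:R.
  have [->|s0] := eqVneq s 0.
    by rewrite act1 eq_sym (negPf (order2_neq0 hu)) subr0.
  have [->|su] := eqVneq s u; first by rewrite act_u formNl se.
  apply/eqP; rewrite subrr; apply/negPn/negP=> se0.
  case: (short_orthogonal (act_short s se) se se0) => E.
    by move: s0; rewrite (short_stabilizer_trivial hu se invL E) eqxx.
  move: su; rewrite -subr_eq0 -(order2_opp hu) opprK.
  suff /(short_stabilizer_trivial hu se invL) -> : act (s + u) e = e.
    by rewrite eqxx.
  by rewrite act_addu E opprK.
split=> //; have [S hS] := half_system_exists hu.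
case: invL => + _ _; rewrite -(half_system_card hS) => -[b b_basis].
apply: (generates_comp (h := enum_val)).
exact: orthonormal_generates b_basis (half_system_orthonormal hS eE).
Qed.

(** The half orbit is an orthonormal basis, with the identity as Gram matrix, and the same [e]
    serves for every [m]. *)
Lemma Gframe_invertible (L : Glattice u) (e : L) : Gframe e -> invertible L.
Proof.
case=> gen eE; have [S hS] := half_system_exists hu.
have von := half_system_orthonormal hS eE.
have b_basis : is_Zbasis (fun i : 'I_#|S| => act (enum_val i) e).
  split; last exact: orthonormal_independent.
  move=> x; have [c ->] := gen x; rewrite (half_system_act _ _ hS) big_enum_val.
  by exists (fun i => c (enum_val i) - c (enum_val i + u)).
split=> [||m _].
- by rewrite -(half_system_card hS); eexists; exact: b_basis.
- exists #|S|; eexists; split; first exact: b_basis.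
  rewrite -(det1 _ #|S|); congr (\det _).
  by apply/matrixP=> i j; rewrite !mxE von.
- exists e; apply/generates_quot_mulP => x; have [c E] := gen x.
  by exists c, 0; rewrite mul0rn addr0.
Qed.

(** The two orbits have equal Gram functions, which makes [f] an isometry, hence injective by
    positivity. Surjectivity and equivariance are read off on the generating orbits. *)
Lemma Gframe_Giso_extension (L M : Glattice u) (e : L) (e' : M) (f : L -> M) :
  Gframe e -> Gframe e' -> {morph f : x y / x + y} ->
  (forall s, f (act s e) = act s e') -> Giso f.
Proof.
move=> [gen eE] [gen' eE'] fD fE.
have fI : forall x y, form (f x) (f y) = form x y.
  apply: (isometry_on_generators fD gen) => s t.
  by rewrite !fE !form_act eE eE'.
split=> //.
- have /choice[g fg] : forall y, exists x, f x = y.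
    move=> y; have [c ->] := gen' y; exists (\sum_s act s e *~ c s).
    by rewrite (morphD_lincomb _ _ _ fD); apply: eq_bigr => s _; rewrite fE.
  by exists g => // x; apply: (isometry_inj fD fI).
- move=> s x; have [c ->] := gen x.
  rewrite (morphD_lincomb _ _ _ (actD s)) !(morphD_lincomb _ _ _ fD).
  rewrite (morphD_lincomb _ _ _ (actD s)); apply: eq_bigr => t _.
  by rewrite -actM !fE -actM.
Qed.

Lemma Giso_Gframe (L M : Glattice u) (f : L -> M) (e : L) :
  Giso f -> Gframe e -> Gframe (f e).
Proof.
move=> [fD [g _ gK] fI fA] [gen eE]; split=> [y|s]; last by rewrite -fA fI.
have [c gy] := gen (g y); exists c; rewrite -[LHS]gK gy.
by rewrite (morphD_lincomb _ _ _ fD); apply: eq_bigr => s _; rewrite fA.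
Qed.

Lemma Giso_inv (L M : Glattice u) (f : L -> M) :
  Giso f -> exists g : M -> L, Giso g.
Proof.
move=> [fD [g fK gK] fI fA]; exists g; split=> [x y||x y|s x].
- by apply: (can_inj fK); rewrite fD !gK.
- by exists f.
- by rewrite -fI !gK.
- by apply: (can_inj fK); rewrite fA !gK.
Qed.

(** * Comparison with the standard [G]-lattice *)

Local Notation ZG := (group_ring G).
Local Notation pi := (\pi_(ZuG u)).

Lemma gr_lincomb (a : ZG) : a = \sum_s gr_elt s *~ a s.
Proof.
apply/ffunP=> s; rewrite sum_ffunE (bigD1 s) //= big1 => [|t ts].
  by rewrite ffunMzE ffunE eqxx addr0 intz.
by rewrite ffunMzE ffunE eq_sym (negPf ts) mul0rz.
Qed.

Lemma standard_Gframe : Gframe ((1 : ZuG u) : standard_Glattice hu).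
Proof.
split=> [x|s].
  exists (repr (x : ZuG u) : ZG).
  rewrite -{1}[x](reprK (x : ZuG u)) {1}(gr_lincomb (repr (x : ZuG u))).
  rewrite raddf_sum; apply: eq_bigr => s _.
  by rewrite raddfMz; congr (_ *~ _); rewrite /= /Zu_act mulr1.
rewrite /= /Zu_act mulr1 -[1 in LHS](rmorph1 pi) Zu_formE //.
by rewrite /gr_t !(gr_mulE s) !ffunE !opprB subr0 subr_eq0.
Qed.

(** Evaluation [a |-> a e] on Z[G] kills the ideal of [u + 1], because [u] acts as -1, and so
    descends to the quotient. *)
Lemma Gframe_Giso (L : Glattice u) (e : L) : Gframe e ->
  exists2 f : standard_Glattice hu -> L, Giso f & f (1 : ZuG u) = e.
Proof.
move=> eF.
pose ev (a : ZG) : L := \sum_s act s e *~ a s.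
have evD : {morph ev : a b / a + b}.
  move=> a b; rewrite /ev -big_split; apply: eq_bigr => s _.
  by rewrite ffunE mulrzDr_tmp.
have ev_elt s : ev (gr_elt s) = act s e.
  rewrite /ev (bigD1 s) //= ffunE eqxx mulr1z big1 ?addr0 // => t ts.
  by rewrite ffunE (negPf ts) mulr0z.
have ev_ideal c : ev (c * (gr_elt u + 1)) = 0.
  rewrite mulrDr mulr1 mulrC evD /ev (reindex_inj (addIr u)) /=.
  rewrite -big_split big1 // => s _ /=.
  by rewrite (gr_mulE u) addrK act_addu mulNrz addNr.
(* Defined through a chosen representative; [fE] shows that the choice does not matter. *)
pose f (x : standard_Glattice hu) : L := ev (repr (x : ZuG u)).
have fE a : f (pi a) = ev a.
  have /eqP := reprK (pi a); rewrite -Quotient.idealrBE => /asboolP[c /eqP].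
  by rewrite /f subr_eq => /eqP ->; rewrite evD ev_ideal add0r.
have fA s : f (act s ((1 : ZuG u) : standard_Glattice hu)) = act s e.
  by rewrite -ev_elt -fE /= /Zu_act mulr1.
exists f; last by rewrite -[RHS]act1 -fA act1.
apply: Gframe_Giso_extension standard_Gframe eF _ fA => x y.
rewrite -[x](reprK (x : ZuG u)) -[y](reprK (y : ZuG u)).
by rewrite -[X in f X](rmorphD pi) !fE evD.
Qed.

Lemma Giso_ext (L M : Glattice u) (f g : L -> M) (e : L) :
  Giso f -> Giso g -> Gframe e -> f e = g e -> f =1 g.
Proof.
move=> [fD _ _ fA] [gD _ _ gA] [gen _] fg x; have [c ->] := gen x.
rewrite (morphD_lincomb _ _ _ fD) (morphD_lincomb _ _ _ gD).
by apply: eq_bigr => s _; rewrite fA gA fg.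
Qed.

(** For injectivity, [s e = t e] gives the Gram function the value 1 at [s - t], which happens only
    at 0. For surjectivity, a short vector cannot be orthogonal to a generating orbit, so it is some
    [s e] or [- s e], the latter being [(s + u) e]. *)
Lemma Gframe_orbit_bij (L : Glattice u) (e : L) : Gframe e ->
  set_bij [set: G]%classic [set e' : L | short e']%classic (fun s => act s e).
Proof.
move=> eF; have se := Gframe_short eF; have [gen eE] := eF.
split=> [s _|s t _ _ /act_eqP E|e' /= se'].
- exact: act_short.
- apply/eqP; rewrite -subr_eq0; have := eE (s - t); rewrite E se.
  by case: eqP => // _; case: eqP.
have [c e'E] := gen e'.
have /existsP[s s0] : [exists s, form (act s e) e' != 0].
  rewrite -negb_forall; apply/negP=> /forallP e'0.
  have := form_lincombl xpredT (fun s => act s e) c e'.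
  rewrite -e'E se' big1 // => s _.
  by rewrite (eqP (e'0 s)) mulr0.
case: (short_orthogonal (act_short s se) se' s0) => E; first by exists s.
by exists (s + u) => //; rewrite act_addu // E opprK.
Qed.

End Frames.

(** * The four assertions, deduced from frames *)

Local Open Scope classical_set_scope.

Theorem theorem12p4 (G : finZmodType) (u : G) (hu : #[u]%g = 2%N)
    (L : Glattice u) :
  [/\ (invertible L ->
         set_bij [set f : standard_Glattice hu -> L | Giso f]
                 [set e : L | short e]
                 (fun f => f (1 : ZuG u))),
      (forall e : L, short e -> invertible L ->
         generates (fun s : G => act s e)),
      (Gisomorphic L (standard_Glattice hu) <->
         invertible L /\ exists e : L, short e)
    & (forall e : L, short e -> invertible L ->
         set_bij [set: G] [set e' : L | short e'] (fun s : G => act s e))].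
Proof.
have frame (e : L) : short e -> invertible L -> Gframe e.
  by move=> se invL; exact: (invertible_short_Gframe hu).
split.
- move=> invL; split=> [f /= fG|f g|e /= se].
  + exact/(Gframe_short hu)/(Giso_Gframe fG)/standard_Gframe.
  + rewrite !inE => fG gG fg.
    exact/funext/(Giso_ext fG gG (standard_Gframe hu)).
  + have [f fG fe] := Gframe_Giso hu (frame e se invL).
    by exists f.
- by move=> e se invL; case: (frame e se invL).
(* The isomorphism starts at [L]; its inverse carries the frame 1 of the standard lattice to [L]. *)
- split=> [[f /Giso_inv[g gG]]|[invL [e se]]].
    have eF := Giso_Gframe gG (standard_Gframe hu).
    split; first exact: (Gframe_invertible hu eF).
    by eexists; exact: (Gframe_short hu eF).
  by have [f /Giso_inv fG _] := Gframe_Giso hu (frame e se invL).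
- by move=> e se invL; apply: (Gframe_orbit_bij hu); exact: frame.
Qed.
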